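(* Let $A\in\mathbb{R}^{m\times n}$ and $r_\theta\in\mathbb{R}^m$, and write $\mu=\mu(A,r_\theta)$. If $\mu(A,r_\theta)>0$, then $$\mu(A,r_\theta)=\max_{\|p\|_2=1}\frac{2|p^TA^Tr_\theta|}{\|Ap+r_\theta\|_2+\|Ap-r_\theta\|_2},$$ where the maximum is over $p\in\mathbb{R}^n$, and the maximum is attained by $$p\propto\left(A^TA+(\|r_\theta\|_2^2-\mu^2)I\right)^{-1}A^Tr_\theta.$$
   Context: Here $m,n$ are positive integers, and $\propto$ means ''proportional to'' (with $p$ normalized so that $\|p\|_2=1$). For real matrices $A\in\mathbb{R}^{m\times n}$ and $R\in\mathbb{R}^{m\times d}$ with the same number of rows, define the backward error $$\mu(A,R)=\min_Y\left(\|YY^\dagger A\|_F^2+\|(I-YY^\dagger)R\|_F^2\right)^{1/2},$$ where $Y$ ranges over all real matrices with $m$ rows (any number of columns), $Y^\dagger$ is the Moore-Penrose inverse of $Y$ (so $YY^\dagger$ ranges over all orthogonal projectors on $\mathbb{R}^m$), and $\|\cdot\|_F$ is the Frobenius norm. Vectors in $\mathbb{R}^m$ are viewed as $m\times 1$ matrices.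
   Formalization: The formula for the maximizer is claimed only when the displayed matrix is invertible (proved whenever μ < ‖r_θ‖₂); the inverse need not exist when μ = ‖r_θ‖₂, e.g. A = (1 1), r_θ = 1. *)

(* Defs.v *)
From HB Require Import structures.
From mathcomp Require Import all_boot all_order all_algebra.
From mathcomp Require Import boolp classical_sets functions reals.
From mathcomp Require Import topology normedtype derive realfun.

Set Implicit Arguments.
Unset Strict Implicit.
Unset Printing Implicit Defensive.

Import Order.TTheory GRing.Theory Num.Theory.
Import numFieldNormedType.Exports.

Local Open Scope classical_set_scope.
Local Open Scope ring_scope.

(* Not the norm `|A| of MathComp-Analysis on matrices, which is the sup norm.
   On a column vector this is the Euclidean norm. *)
Definition frob (R : realType) (m n : nat) (A : 'M[R]_(m, n)) : R :=
  Num.sqrt (\sum_i \sum_j A i j ^+ 2).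

Definition penrose (R : realType) (m k : nat)
    (Y : 'M[R]_(m, k)) (X : 'M[R]_(k, m)) : Prop :=
  [/\ Y *m X *m Y = Y, X *m Y *m X = X,
      (Y *m X)^T = Y *m X & (X *m Y)^T = X *m Y].

(* The default value 0 is never used, see [mpinvP]; [pinvmx] of mxalgebra is
   only some generalized inverse. *)
Definition mpinv (R : realType) (m k : nat) (Y : 'M[R]_(m, k)) :
  'M[R]_(k, m) := xget 0 [set X | penrose Y X].

Definition backward_errors (R : realType) (m n d : nat)
    (A : 'M[R]_(m, n)) (B : 'M[R]_(m, d)) : set R :=
  [set v | exists (k : nat) (Y : 'M[R]_(m, k)),
     v = Num.sqrt (frob (Y *m mpinv Y *m A) ^+ 2
                   + frob ((1%:M - Y *m mpinv Y) *m B) ^+ 2)].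

Definition is_min (R : realType) (S : set R) (v : R) : Prop :=
  S v /\ lbound S v.

Definition is_max (R : realType) (S : set R) (v : R) : Prop :=
  S v /\ ubound S v.

(* The infimum is a minimum, see [backward_error_min]. *)
Definition backward_error (R : realType) (m n d : nat)
    (A : 'M[R]_(m, n)) (B : 'M[R]_(m, d)) : R :=
  inf (backward_errors A B).

Definition error_ratio (R : realType) (m n : nat)
    (A : 'M[R]_(m, n)) (r : 'cV[R]_m) (p : 'cV[R]_n) : R :=
  2 * `|(p^T *m A^T *m r) 0 0| / (frob (A *m p + r) + frob (A *m p - r)).

Lemma mulmx_tr_eq0 (R : realType) (m n : nat) (A : 'M[R]_(m, n)) :
  A *m A^T = 0 -> A = 0.
Proof.
move=> AA0; apply/matrixP => i j; rewrite mxE.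
have /eqP := congr1 (fun M : 'M[R]_m => M i i) AA0; rewrite !mxE.
under eq_bigr do rewrite mxE -expr2.
rewrite psumr_eq0; last by move=> *; exact: sqr_ge0.
by move=> /allP /(_ j (mem_index_enum _)); rewrite sqrf_eq0 => /eqP.
Qed.

Lemma row_free_gram (R : realType) (m n : nat) (A : 'M[R]_(m, n)) :
  row_free A -> A *m A^T \in unitmx.
Proof.
move=> fA; rewrite -row_free_unit -kermx_eq0; apply/eqP.
set K := kermx _; have KA0 : K *m (A *m A^T) = 0 by exact: mulmx_ker.
apply: (row_free_inj fA); rewrite mul0mx; apply: mulmx_tr_eq0.
by rewrite trmx_mul mulmxA -[K *m A *m _]mulmxA KA0 mul0mx.
Qed.

Lemma penrose_exists (R : realType) (m k : nat) (Y : 'M[R]_(m, k)) :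
  exists X, penrose Y X.
Proof.
have : exists r (C : 'M[R]_(m, r)) (F : 'M[R]_(r, k)),
    [/\ Y = C *m F, row_free F & row_free C^T].
  exists (\rank Y), (col_base Y), (row_base Y).
  rewrite mulmx_base row_base_free; split=> //.
  by rewrite /row_free mxrank_tr; exact: col_base_full.
move=> [r [C [F [YE /row_free_gram uF /row_free_gram]]]].
rewrite trmxK => uC.
pose G := invmx (F *m F^T); pose H := invmx (C^T *m C).
have GT : G^T = G by rewrite /G trmx_inv trmx_mul trmxK.
have HT : H^T = H by rewrite /H trmx_inv trmx_mul trmxK.
have FG : F *m F^T *m G = 1%:M by rewrite mulmxV.
have HC : H *m (C^T *m C) = 1%:M by rewrite mulVmx.
pose X := F^T *m G *m (H *m C^T).
have YX : Y *m X = C *m (H *m C^T).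
  by rewrite YE /X -!mulmxA (mulmxA F) (mulmxA (F *m _)) FG mul1mx.
have XY : X *m Y = F^T *m G *m F.
  by rewrite YE /X -!mulmxA (mulmxA C^T) (mulmxA H) HC mul1mx.
exists X; split.
- by rewrite YX YE -!mulmxA (mulmxA C^T) (mulmxA H) HC mul1mx.
- by rewrite XY /X -!mulmxA (mulmxA F) (mulmxA (F *m _)) FG mul1mx.
- by rewrite YX !trmx_mul trmxK HT mulmxA.
- by rewrite XY !trmx_mul trmxK GT mulmxA.
Qed.

Lemma mpinvP (R : realType) (m k : nat) (Y : 'M[R]_(m, k)) :
  penrose Y (mpinv Y).
Proof. by have [X PX] := penrose_exists Y; exact: (xgetI 0 PX). Qed.

Lemma penrose_inj (R : realType) (m k : nat) (Y : 'M[R]_(m, k))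
    (X Z : 'M[R]_(k, m)) : penrose Y X -> penrose Y Z -> X = Z.
Proof.
move=> [x1 x2 x3 x4] [z1 z2 z3 z4].
have YXZ : Y *m X = Y *m Z.
  by rewrite -x3 -{1}z1 -mulmxA trmx_mul x3 z3 mulmxA x1.
have XYZ : X *m Y = Z *m Y.
  by rewrite -x4 -{1}z1 -mulmxA mulmxA trmx_mul x4 z4 -mulmxA (mulmxA Y) x1.
by rewrite -x2 XYZ -mulmxA YXZ mulmxA z2.
Qed.

Lemma sum_continuous (R : realType) (T : topologicalType) (n : nat)
    (g : 'I_n -> T -> R) :
  (forall i, continuous (g i)) -> continuous (fun t => \sum_i g i t).
Proof.
elim: n g => [|n IH] g cg t.
  by under eq_fun do rewrite big_ord0; exact: cvg_cst.
under eq_fun do rewrite big_ord_recl.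
apply: cvgD; first exact: cg.
by apply: (IH (fun i => g (lift ord0 i))) => i; exact: cg.
Qed.

Lemma frob_continuous (R : realType) (T : topologicalType) (m n : nat)
    (M : T -> 'M[R]_(m, n)) :
  (forall i j, continuous (fun t => M t i j)) ->
  continuous (fun t => frob (M t)).
Proof.
move=> cM t; apply: (@continuous_comp _ _ _ _ Num.sqrt); last first.
  exact: sqrt_continuous.
by apply: sum_continuous => i; apply: sum_continuous => j u;
   apply: cvgM; exact: cM.
Qed.

Lemma submx_entry_continuous (R : realType) (T : topologicalType)
    (m n : nat) (M N : T -> 'M[R]_(m, n)) :
  (forall i j, continuous (fun t => M t i j)) ->
  (forall i j, continuous (fun t => N t i j)) ->
  forall i j, continuous (fun t => (M t - N t) i j).
Proof.
move=> cM cN i j; under eq_fun do rewrite !mxE.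
by move=> t; apply: cvgB; [exact: cM|exact: cN].
Qed.

Lemma mulmx_entry_continuous (R : realType) (T : topologicalType)
    (m n d : nat) (M : T -> 'M[R]_(m, n)) (N : T -> 'M[R]_(n, d)) :
  (forall i j, continuous (fun t => M t i j)) ->
  (forall i j, continuous (fun t => N t i j)) ->
  forall i j, continuous (fun t => (M t *m N t) i j).
Proof.
move=> cM cN i j; under eq_fun do rewrite mxE.
by apply: sum_continuous => l t; apply: cvgM; [exact: cM|exact: cN].
Qed.

Lemma frob0 (R : realType) (m n : nat) : frob (0 : 'M[R]_(m, n)) = 0.
Proof.
rewrite /frob big1 ?sqrtr0// => i _.
by rewrite big1// => j _; rewrite mxE expr0n.
Qed.

Lemma frob_eq0 (R : realType) (m n : nat) (A : 'M[R]_(m, n)) :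
  frob A = 0 -> A = 0.
Proof.
have S0 i : 0 <= \sum_j A i j ^+ 2 by apply: sumr_ge0 => j _; exact: sqr_ge0.
move=> /eqP; rewrite sqrtr_eq0 => h; apply/matrixP => i j; rewrite mxE.
have /eqP : \sum_i \sum_j A i j ^+ 2 = 0.
  by apply/eqP; rewrite eq_le h sumr_ge0.
rewrite psumr_eq0// => /allP /(_ i (mem_index_enum _)) /=.
rewrite psumr_eq0; last by move=> *; exact: sqr_ge0.
by move=> /allP /(_ j (mem_index_enum _)); rewrite sqrf_eq0 => /eqP.
Qed.

Lemma projector_entry_le1 (R : realType) (m : nat) (P : 'M[R]_m) i j :
  P *m P = P -> P^T = P -> `|P i j| <= 1.
Proof.
move=> PP PT.
have sq l : P i l ^+ 2 <= P i i.
  rewrite -{2}PP -{3}PT mxE (bigD1 l)//= mxE -expr2 lerDl sumr_ge0// => l' _.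
  by rewrite mxE -expr2 sqr_ge0.
have Pii0 : 0 <= P i i by apply: le_trans (sq i); exact: sqr_ge0.
have Pii1 : P i i <= 1.
  rewrite leNgt; apply/negP => lt1; have := sq i.
  by rewrite expr2 -{3}[P i i]mulr1 ler_pM2l ?(lt_trans ltr01)// leNgt lt1.
by rewrite -(@expr_le1 _ 2)// real_normK ?num_real// (le_trans (sq j)).
Qed.

Lemma backward_error_min (R : realType) (m n d : nat)
    (A : 'M[R]_(m, n)) (B : 'M[R]_(m, d)) :
  is_min (backward_errors A B) (backward_error A B).
Proof.
pose f (P : 'M[R]_m) := Num.sqrt (frob (P *m A) ^+ 2
                                  + frob ((1%:M - P) *m B) ^+ 2).
pose D := [set v : 'rV[R]_(m * m) |
             vec_mx v *m vec_mx v = vec_mx v /\ (vec_mx v)^T = vec_mx v].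
pose V (v : 'rV[R]_(m * m)) : 'M[R]_m := vec_mx v.
have cV i j : continuous (fun v => V v i j).
  by under eq_fun do rewrite mxE; move=> v; exact: coord_continuous.
have cB : forall i j, continuous (fun v => (V v *m V v - V v) i j).
  by apply: submx_entry_continuous => //; exact: mulmx_entry_continuous.
have cS : forall i j, continuous (fun v => ((V v)^T - V v) i j).
  apply: submx_entry_continuous => // i j.
  by under eq_fun do rewrite [_^T _ _]mxE; exact: cV.
have cC : forall i j, continuous (fun v => (1%:M - V v) i j).
  by apply: submx_entry_continuous => [i j|//]; exact: cst_continuous.
have clD : closed D.
  have -> : D = (fun v => frob (V v *m V v - V v)) @^-1` [set x | x = 0]
      `&` (fun v => frob ((V v)^T - V v)) @^-1` [set x | x = 0].
    apply/seteqP; split=> v /= => [[h1 h2]|[/frob_eq0 h1 /frob_eq0 h2]].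
      by rewrite /V h1 h2 subrr frob0.
    by split; apply/eqP; rewrite -subr_eq0; apply/eqP.
  by apply: closedI; apply: preimage_closed (@closed_eq _ 0) => v _;
     exact: frob_continuous.
have cpD : compact D.
  apply: (subclosed_compact clD (@rV_compact _ _
    (fun=> `[(-1 : R), 1]%classic) (fun=> @segment_compact _ _ _))).
  move=> v [h1 h2] l /=; rewrite in_itv/= -ler_norml.
  case/mxvec_indexP: l => i j.
  by have := projector_entry_le1 i j h1 h2; rewrite mxE.
have D0 : D !=set0 by exists 0; rewrite /D/= linear0 mulmx0 trmx0.
have cf : continuous (fun v => f (V v)).
  have cg : continuous (fun v => frob (V v *m A) ^+ 2
                                 + frob ((1%:M - V v) *m B) ^+ 2).
    have cA : continuous (fun v => frob (V v *m A)).
      apply: frob_continuous; apply: mulmx_entry_continuous => [//|i j].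
      exact: cst_continuous.
    have cB' : continuous (fun v => frob ((1%:M - V v) *m B)).
      apply: frob_continuous; apply: mulmx_entry_continuous => [//|i j].
      exact: cst_continuous.
    by move=> v; exact: cvgD (cvgM (cA v) (cA v)) (cvgM (cB' v) (cB' v)).
  by move=> v; apply: continuous_comp (cg v) (@sqrt_continuous _ _).
have [v vD vmin] := compact_EVT_min D0 cpD (continuous_subspaceT cf).
move/set_mem: vD => [v1 v2].
have vP : mpinv (V v) = V v.
  by apply: (penrose_inj (mpinvP _)); split; rewrite !v1.
have vS : backward_errors A B (f (V v)).
  by exists m, (V v); rewrite vP v1.
have vlb : lbound (backward_errors A B) (f (V v)).
  move=> _ [k [Y ->]]; have [y1 _ y3 _] := mpinvP Y.
  rewrite -[Y *m mpinv Y]mxvecK; apply: (vmin (mxvec (Y *m mpinv Y))).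
  by apply/mem_set; rewrite /D/= mxvecK mulmxA y1.
suff -> : backward_error A B = f (V v) by [].
apply/eqP; rewrite eq_le; apply/andP; split.
  by apply: ge_inf => //; exists (f (V v)).
by apply: lb_le_inf => //; exists (f (V v)).
Qed.

(* Main.v *)
Require Import Defs.
From HB Require Import structures.
From mathcomp Require Import all_boot all_order all_algebra.
From mathcomp Require Import boolp classical_sets reals.
From mathcomp Require Import ring lra.

Import Order.TTheory GRing.Theory Num.Theory.
Local Open Scope classical_set_scope.
Local Open Scope ring_scope.

(** Write mu for the backward error, s = |r|^2 - mu^2 and G = A A^T + s I.
    For orthogonal projectors P,
      |P A|^2 + |(I - P) r|^2 = |r|^2 + tr (P (A A^T - r r^T)),
    so mu^2 is |r|^2 plus the sum of the negative eigenvalues of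
    A A^T - r r^T, a matrix which has at most one of them.  The proof uses this
    only through comparisons with explicit projectors, not through spectral
    theory.

    Upper bound on the ratio ([error_ratio_le]).  With x = A p, polarization
    turns the ratio into half the difference of the lengths |x + r| and
    |x - r| ([error_ratioE]).  If P is an optimal projector, the reflection
    I - 2 P preserves the length of x - r and brings it to distance
    2 |P x + (I - P) r| from x + r.  The reverse triangle inequality and
    Pythagoras then bound the ratio by the square root of
    |P x|^2 + |(I - P) r|^2, hence by mu.

    Attainment.  Comparing mu with the projectors on lines gives
    (r . y)^2 <= y . G y for all y ([deficit_psd]).  Hence r is orthogonal to
    the kernel of G and G y = r has a solution, for which r . y <= 1
    ([dominating_solvable]).  If s > 0, then - s is the negative eigenvalue,
    and an optimal projector P sends r to a multiple of its eigenvector;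
    testing G on a combination of y and P r gives r . y = 1
    ([certificate_exists]).  For p = c A^T y of norm 1 these relations give
    |A p + r| = mu |c + 1| and |A p - r| = mu |c - 1| with |c| >= 1, so that
    the ratio is mu ([certificate_ratio]).  Finally A^T y solves the
    regularized normal equations (A^T A + s I) q = A^T r
    ([gram_certificate]), which identifies it with the maximizer of the
    theorem whenever that matrix is invertible; if s = 0 and it is singular,
    A^T y is still a maximizer. *)

(** * Euclidean geometry of column vectors *)

Definition dot {R : realType} {n : nat} (u v : 'cV[R]_n) : R :=
  (u^T *m v) 0 0.

Section Dot.
Context {R : realType} {n : nat}.
Implicit Types u v w : 'cV[R]_n.

Lemma dotE u v : dot u v = \sum_i u i 0 * v i 0.
Proof. by rewrite /dot mxE; apply: eq_bigr => i _; rewrite mxE. Qed.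

Lemma dotC u v : dot u v = dot v u.
Proof. by rewrite !dotE; apply: eq_bigr => i _; rewrite mulrC. Qed.

Lemma dotDr u v w : dot u (v + w) = dot u v + dot u w.
Proof. by rewrite /dot mulmxDr mxE. Qed.

Lemma dotZr c u v : dot u (c *: v) = c * dot u v.
Proof. by rewrite /dot -scalemxAr mxE. Qed.

Lemma dotDl u v w : dot (u + v) w = dot u w + dot v w.
Proof. by rewrite dotC dotDr !(dotC w). Qed.

Lemma dotZl c u v : dot (c *: u) v = c * dot u v.
Proof. by rewrite dotC dotZr dotC. Qed.

Lemma dotNr u v : dot u (- v) = - dot u v.
Proof. by rewrite -scaleN1r dotZr mulN1r. Qed.

Lemma dotNl u v : dot (- u) v = - dot u v.
Proof. by rewrite dotC dotNr dotC. Qed.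

Lemma dot0r u : dot u 0 = 0.
Proof. by rewrite /dot mulmx0 mxE. Qed.

Definition dot_linear := (dotDl, dotDr, dotNl, dotNr, dotZl, dotZr).

End Dot.

Lemma dot_mulmxl {R : realType} {m n : nat} (A : 'M[R]_(m, n)) u v :
  dot (A *m u) v = dot u (A^T *m v).
Proof. by rewrite /dot trmx_mul mulmxA. Qed.

Lemma dot_mulmxr {R : realType} {m n : nat} (A : 'M[R]_(m, n)) u v :
  dot u (A *m v) = dot (A^T *m u) v.
Proof. by rewrite dot_mulmxl trmxK. Qed.

Lemma frob_ge0 {R : realType} {m n : nat} (A : 'M[R]_(m, n)) : 0 <= frob A.
Proof. exact: sqrtr_ge0. Qed.

Lemma frob_sqr {R : realType} {m n : nat} (A : 'M[R]_(m, n)) :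
  frob A ^+ 2 = \sum_i \sum_j A i j ^+ 2.
Proof.
by rewrite sqr_sqrtr // sumr_ge0 // => i _; rewrite sumr_ge0 // => j _;
   exact: sqr_ge0.
Qed.

Lemma frob_tr {R : realType} {m n : nat} (A : 'M[R]_(m, n)) :
  frob A^T = frob A.
Proof.
rewrite /frob exchange_big; congr Num.sqrt.
by apply: eq_bigr => i _; apply: eq_bigr => j _; rewrite mxE.
Qed.

Lemma frob_sqr_dot {R : realType} {n : nat} (u : 'cV[R]_n) :
  frob u ^+ 2 = dot u u.
Proof.
by rewrite frob_sqr dotE; apply: eq_bigr => i _; rewrite big_ord1 expr2.
Qed.

Lemma frobZ {R : realType} {n : nat} (c : R) (u : 'cV[R]_n) :
  frob (c *: u) = `|c| * frob u.
Proof.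
apply/eqP; rewrite -(eqrXn2 (n := 2)) ?mulr_ge0 ?frob_ge0 // exprMn.
by rewrite real_normK ?num_real // !frob_sqr_dot dotZl dotZr mulrA -expr2.
Qed.

Lemma frob_sqr_outer {R : realType} {m n : nat} (u : 'cV[R]_m)
    (v : 'cV[R]_n) : frob (u *m v^T) ^+ 2 = dot u u * dot v v.
Proof.
rewrite frob_sqr !dotE mulr_suml; apply: eq_bigr => i _.
rewrite mulr_sumr; apply: eq_bigr => j _.
by rewrite mxE big_ord1 mxE; ring.
Qed.

Lemma dot_ge0 {R : realType} {n : nat} (u : 'cV[R]_n) : 0 <= dot u u.
Proof. by rewrite -frob_sqr_dot sqr_ge0. Qed.

Lemma dot_eq0 {R : realType} {n : nat} (u : 'cV[R]_n) : dot u u = 0 -> u = 0.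
Proof.
by rewrite -frob_sqr_dot => /eqP; rewrite sqrf_eq0 => /eqP /frob_eq0.
Qed.

Lemma dot_gt0 {R : realType} {n : nat} (u : 'cV[R]_n) :
  u != 0 -> 0 < dot u u.
Proof.
by move=> u0; rewrite lt0r dot_ge0 andbT; apply: contra_neq u0 => /dot_eq0.
Qed.

Lemma cauchy_schwarz {R : realType} {n : nat} (u v : 'cV[R]_n) :
  dot u v ^+ 2 <= dot u u * dot v v.
Proof.
have [->|/dot_gt0 v0] := eqVneq v 0.
  by rewrite !dot0r mulr0 expr0n.
have := dot_ge0 (dot v v *: u - dot u v *: v).
rewrite !dot_linear (dotC v u).
set a := dot u u; set b := dot u v; set c := dot v v => h.
rewrite -subr_ge0 -(pmulr_rge0 _ v0) -/c.
by rewrite (_ : c * _ = c * (c * a) - c * (b * b)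
  - (b * (c * b) - b * (b * c))); [lra|ring].
Qed.

Lemma frob_ler_dist {R : realType} {n : nat} (u v : 'cV[R]_n) :
  `|frob u - frob v| <= frob (u - v).
Proof.
rewrite -ler_sqr ?nnegrE ?frob_ge0 // real_normK ?num_real //.
rewrite sqrrB !frob_sqr_dot !dot_linear (dotC v u).
have : dot u v <= frob u * frob v.
  apply: le_trans (ler_norm _) _.
  rewrite -ler_sqr ?nnegrE ?mulr_ge0 ?frob_ge0 // real_normK ?num_real //.
  by rewrite exprMn !frob_sqr_dot cauchy_schwarz.
by rewrite mulr2n; lra.
Qed.

Lemma frob_mulmx_le {R : realType} {m n : nat} (A : 'M[R]_(m, n))
    (u : 'cV[R]_n) : frob (A *m u) ^+ 2 <= frob A ^+ 2 * frob u ^+ 2.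
Proof.
rewrite !(frob_sqr A) !frob_sqr_dot dotE mulr_suml; apply: ler_sum => i _.
have -> : (A *m u) i 0 = dot (row i A)^T u.
  by rewrite /dot trmxK -row_mul [RHS]mxE.
rewrite -expr2; apply: le_trans (cauchy_schwarz _ _) _.
rewrite ler_wpM2r ?dot_ge0 // dotE.
by under eq_bigr do rewrite !mxE -expr2.
Qed.

(** * The backward error as a minimum over orthogonal projectors *)

Definition projector {R : realType} {m : nat} (P : 'M[R]_m) : Prop :=
  P *m P = P /\ P^T = P.

Lemma projector_dot {R : realType} {m : nat} (P : 'M[R]_m) (u : 'cV[R]_m) :
  projector P -> dot (P *m u) u = dot (P *m u) (P *m u).
Proof. by case=> PP PT; rewrite dot_mulmxr PT mulmxA PP. Qed.

Lemma projector_compl_sqr {R : realType} {m : nat} (P : 'M[R]_m)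
    (u : 'cV[R]_m) :
  projector P ->
  frob ((1%:M - P) *m u) ^+ 2 = frob u ^+ 2 - frob (P *m u) ^+ 2.
Proof.
move=> /(projector_dot _ u) Pu; rewrite mulmxBl mul1mx !frob_sqr_dot.
by rewrite !dot_linear (dotC u) Pu; ring.
Qed.

(** Every Y Y^+ is an orthogonal projector.  Together with
    [backward_error_le], this lets the rest of the proof speak of projectors
    only. *)
Lemma backward_error_attained {R : realType} {m n d : nat}
    (A : 'M[R]_(m, n)) (B : 'M[R]_(m, d)) :
  exists2 P : 'M[R]_m, projector P &
    backward_error A B ^+ 2
    = frob (P *m A) ^+ 2 + frob ((1%:M - P) *m B) ^+ 2.
Proof.
have [[k [Y ->]] _] := backward_error_min A B.
have [y1 _ y3 _] := mpinvP Y.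
exists (Y *m mpinv Y); first by split; rewrite // mulmxA y1.
by rewrite sqr_sqrtr // addr_ge0 // sqr_ge0.
Qed.

Lemma backward_error_ge0 {R : realType} {m n d : nat}
    (A : 'M[R]_(m, n)) (B : 'M[R]_(m, d)) : 0 <= backward_error A B.
Proof. by have [[k [Y ->]] _] := backward_error_min A B; exact: sqrtr_ge0. Qed.

Lemma backward_error_le {R : realType} {m n d : nat}
    (A : 'M[R]_(m, n)) (B : 'M[R]_(m, d)) (P : 'M[R]_m) :
  projector P ->
  backward_error A B ^+ 2
  <= frob (P *m A) ^+ 2 + frob ((1%:M - P) *m B) ^+ 2.
Proof.
move=> [PP PT].
have vP : mpinv P = P.
  by apply: (penrose_inj (mpinvP _)); split; rewrite !PP.
have [_ lb] := backward_error_min A B.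
have S0 : 0 <= frob (P *m A) ^+ 2 + frob ((1%:M - P) *m B) ^+ 2.
  by rewrite addr_ge0 // sqr_ge0.
rewrite -[leRHS]sqr_sqrtr // ler_sqr ?nnegrE ?sqrtr_ge0 ?backward_error_ge0 //.
by apply: lb; exists m, P; rewrite vP PP.
Qed.

Lemma backward_error_le_frob {R : realType} {m n : nat}
    (A : 'M[R]_(m, n)) (r : 'cV[R]_m) :
  backward_error A r ^+ 2 <= frob r ^+ 2.
Proof.
have := backward_error_le A r 0; rewrite subr0 mul1mx mul0mx frob0.
by rewrite expr0n add0r; apply; split; rewrite ?mul0mx ?trmx0.
Qed.

Lemma rank1_projector {R : realType} {m : nat} (y : 'cV[R]_m) :
  y != 0 -> projector ((dot y y)^-1 *: (y *m y^T)).
Proof.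
move=> /dot_gt0 /lt0r_neq0 y0; split.
  rewrite -scalemxAl -scalemxAr mulmxA -(mulmxA y) [y^T *m y]mx11_scalar.
  rewrite -/(dot y y) mul_mx_scalar -scalemxAl !scalerA.
  by rewrite mulVf ?mulr1.
by rewrite linearZ /= trmx_mul trmxK.
Qed.

(** The projector on the line of y cannot beat the minimum. *)
Lemma deficit_psd {R : realType} {m n : nat} (A : 'M[R]_(m, n))
    (r y : 'cV[R]_m) :
  dot r y ^+ 2 <= dot (A^T *m y) (A^T *m y)
                  + (frob r ^+ 2 - backward_error A r ^+ 2) * dot y y.
Proof.
have [->|y0] := eqVneq y 0.
  by rewrite mulmx0 !dot0r mulr0 expr0n addr0.
have Py := rank1_projector y y0; have := backward_error_le A r _ Py.
rewrite projector_compl_sqr //.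
have t0 := dot_gt0 y y0; set t := dot y y in Py t0 *.
have -> : t^-1 *: (y *m y^T) *m A = y *m (t^-1 *: (A^T *m y))^T.
  by rewrite linearZ /= trmx_mul trmxK -scalemxAr -scalemxAl mulmxA.
have -> : t^-1 *: (y *m y^T) *m r = (t^-1 * dot r y) *: y.
  rewrite -scalemxAl -mulmxA [y^T *m r]mx11_scalar mul_mx_scalar scalerA.
  by rewrite dotC.
rewrite frob_sqr_outer !frob_sqr_dot !dot_linear -/t.
set a := dot _ _; set b := dot r y; set f := dot r r; set g := _ ^+ 2 => h.
have := ler_wpM2r (ltW t0) h; have t1 := lt0r_neq0 t0.
have -> : (t * (t^-1 * (t^-1 * a)) + (f - t^-1 * b * (t^-1 * b * t))) * t
          = a + f * t - b ^+ 2 by field.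
by lra.
Qed.

(** * Upper bound on the ratio by reflection *)

Lemma dot_polarization {R : realType} {m : nat} (x r : 'cV[R]_m) :
  (frob (x + r) - frob (x - r)) * (frob (x + r) + frob (x - r))
  = 4 * dot x r.
Proof.
by rewrite -subr_sqr !frob_sqr_dot !dot_linear (dotC r x); ring.
Qed.

(** The denominator of the ratio cancels in the polarization identity.  When
    it vanishes, both sides are 0, as division by 0 gives 0. *)
Lemma error_ratioE {R : realType} {m n : nat} (A : 'M[R]_(m, n))
    (r : 'cV[R]_m) (p : 'cV[R]_n) :
  error_ratio A r p = `|frob (A *m p + r) - frob (A *m p - r)| / 2.
Proof.
rewrite /error_ratio -trmx_mul -/(dot (A *m p) r).
set x := A *m p; have := dot_polarization x r.
set a := frob _; set b := frob _ => h.
have a0 : 0 <= a by exact: frob_ge0.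
have b0 : 0 <= b by exact: frob_ge0.
have [ab|ab] := eqVneq (a + b) 0.
  have [-> ->] : a = 0 /\ b = 0 by split; lra.
  by rewrite addr0 invr0 mulr0 subrr normr0 mul0r.
have -> : dot x r = (a - b) * (a + b) / 4 by rewrite h; field.
rewrite !normrM (ger0_norm (addr_ge0 a0 b0)) normfV normr_nat.
by field.
Qed.

(** Reflecting A p - r across the kernel of an optimal projector brings it
    close to A p + r without changing its length. *)
Lemma error_ratio_le {R : realType} {m n : nat} (A : 'M[R]_(m, n))
    (r : 'cV[R]_m) (p : 'cV[R]_n) :
  frob p = 1 -> error_ratio A r p <= backward_error A r.
Proof.
move=> p1; have [P [PP PT] muE] := backward_error_attained A r.
set x := A *m p.
pose W := 1%:M - 2 *: P.
have W_isom (v : 'cV[R]_m) : frob (W *m v) = frob v.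
  apply/eqP; rewrite -(eqrXn2 (n := 2)) ?frob_ge0 // !frob_sqr_dot.
  rewrite mulmxBl mul1mx -scalemxAl !dot_linear (dotC v).
  by rewrite projector_dot //; apply/eqP; ring.
have key : (x + r) - W *m (x - r) = 2 *: (P *m x + (1%:M - P) *m r).
  rewrite !(mulmxBl, mulmxBr, mul1mx) -!scalemxAl.
  by apply/matrixP => i j; rewrite !mxE; ring.
have orth : frob (P *m x + (1%:M - P) *m r) ^+ 2
            = frob (P *m x) ^+ 2 + frob ((1%:M - P) *m r) ^+ 2.
  have o : dot (P *m x) ((1%:M - P) *m r) = 0.
    rewrite dot_mulmxl PT mulmxA mulmxBr mulmx1 PP subrr mul0mx.
    by rewrite dot0r.
  by rewrite !frob_sqr_dot !dot_linear (dotC _ (P *m x)) o; ring.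
rewrite error_ratioE -/x -(W_isom (x - r)).
apply: (@le_trans _ _ (frob (P *m x + (1%:M - P) *m r))).
  rewrite ler_pdivrMr // (le_trans (frob_ler_dist _ _)) // key.
  rewrite -ler_sqr ?nnegrE ?mulr_ge0 ?frob_ge0 // exprMn !frob_sqr_dot.
  by rewrite !dot_linear; lra.
rewrite -ler_sqr ?nnegrE ?frob_ge0 ?backward_error_ge0 // orth muE lerD2r.
by rewrite mulmxA (le_trans (frob_mulmx_le _ _)) // p1 expr1n mulr1.
Qed.

(** * Vectors that attain the bound *)

(** If G dominates r r^T, then G v = 0 forces r . v = 0, so r is in the range
    of G.  Testing the domination on a solution y of G y = r gives
    (r . y)^2 <= r . y. *)
Lemma dominating_solvable {R : realType} {m : nat} (G : 'M[R]_m)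
    (r : 'cV[R]_m) :
  G^T = G -> (forall y, dot r y ^+ 2 <= dot y (G *m y)) ->
  exists2 y, G *m y = r & dot r y <= 1.
Proof.
move=> GT Gr.
have [w wG] : exists w : 'rV[R]_m, r^T = w *m G.
  apply/submxP; rewrite submxE; apply/eqP/matrixP => i j; rewrite ord1.
  rewrite [RHS]mxE.
  have Gc : G *m col j (cokermx G) = 0.
    by rewrite colE mulmxA mulmx_coker mul0mx.
  have := Gr (col j (cokermx G)); rewrite Gc dot0r /dot.
  have -> : (r^T *m col j (cokermx G)) 0 0 = (r^T *m cokermx G) 0 j.
    by rewrite colE mulmxA -colE mxE.
  move=> h; apply/eqP; rewrite -sqrf_eq0; apply/eqP/le_anti.
  by rewrite h sqr_ge0.
have Gw : G *m w^T = r by rewrite -{1}GT -trmx_mul -wG trmxK.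
exists w^T => //; have := Gr w^T; rewrite Gw (dotC w^T).
set b := dot _ _ => h; rewrite leNgt; apply/negP => b1.
by move: h; rewrite leNgt expr2 ltr_pMr ?(lt_trans ltr01) // b1.
Qed.

Section Certificate.
Context {R : realType} {m n : nat} (A : 'M[R]_(m, n)) (r : 'cV[R]_m).
Let mu := backward_error A r.
Let s := frob r ^+ 2 - mu ^+ 2.

Lemma deficit_ge0 : 0 <= s.
Proof. by rewrite subr_ge0 backward_error_le_frob. Qed.

(** The equation s * (r . y) = s says that r . y = 1 unless s = 0; in that
    form both cases lead to the same computations in [certificate_neq0] and
    [certificate_ratio].  For s > 0, the image w = P r of r under an optimal
    projector satisfies w . G w <= (r . w)^2, the reverse of the inequality
    that holds for all vectors. *)
Lemma certificate_exists :
  exists y : 'cV[R]_m, [/\ (A *m A^T + s%:M) *m y = r, dot r y <= 1 &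
    s * dot r y = s].
Proof.
set G := _ + _.
have GT : G^T = G by rewrite /G linearD /= trmx_mul trmxK tr_scalar_mx.
have GE v : dot v (G *m v) = dot (A^T *m v) (A^T *m v) + s * dot v v.
  by rewrite mulmxDl mul_scalar_mx dotDr dotZr -mulmxA dot_mulmxr.
have Gr v : dot r v ^+ 2 <= dot v (G *m v) by rewrite GE deficit_psd.
have [y Gy ry1] := dominating_solvable G r GT Gr.
exists y; split=> //.
have [->|s0] := eqVneq s 0; first by rewrite mul0r.
suff ry : 1 <= dot r y by rewrite (_ : dot r y = 1) ?mulr1 //; lra.
have [P projP muE] := backward_error_attained A r; have [PP PT] := projP.
rewrite -/mu projector_compl_sqr // in muE.
set w := P *m r in muE; pose t := dot r w.
have tE : t = frob w ^+ 2.
  by rewrite frob_sqr_dot /t dotC projector_dot.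
(* A^T w is (P A)^T w, so its length is at most that of P A times that of w. *)
have AwE : A^T *m w = (P *m A)^T *m w.
  by rewrite trmx_mul PT -mulmxA [P *m w]mulmxA PP.
have Aw : dot (A^T *m w) (A^T *m w) <= frob (P *m A) ^+ 2 * t.
  by rewrite -frob_sqr_dot AwE tE -(frob_tr (P *m A)) frob_mulmx_le.
have t0 : 0 < t.
  have /lt_le_trans : 0 < s by rewrite lt0r s0 deficit_ge0.
  by apply; rewrite /s muE tE; have := sqr_ge0 (frob (P *m A)); lra.
have wGw : dot w (G *m w) <= t ^+ 2.
  rewrite GE -(frob_sqr_dot w) -tE /s.
  have FE : frob (P *m A) ^+ 2 = t - s by rewrite /s muE tE; ring.
  by move: Aw; rewrite FE -/s expr2; lra.
(* Since G y = r, this vector gives r . y - 2 + (w . G w) / t^2, which is at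
   most r . y - 1. *)
have G0 : 0 <= dot (y - t^-1 *: w) (G *m (y - t^-1 *: w)).
  exact: le_trans (sqr_ge0 _) (Gr _).
move: G0; rewrite mulmxBr -scalemxAr Gy !dot_linear.
rewrite (dotC y) (dotC w r) -/t.
have -> : dot y (G *m w) = t by rewrite dot_mulmxr GT Gy.
have -> : t^-1 * t = 1 by rewrite mulVf ?lt0r_neq0.
have : t^-1 * (t^-1 * dot w (G *m w)) <= 1.
  by rewrite mulrA -invfM -expr2 mulrC ler_pdivrMr ?exprn_gt0 // mul1r.
lra.
Qed.

(** If A^T y = 0, then r = s y, hence |r|^2 = s (r . y) = s and mu = 0. *)
Lemma certificate_neq0 y : 0 < mu ->
  (A *m A^T + s%:M) *m y = r -> s * dot r y = s -> A^T *m y != 0.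
Proof.
move=> mu0 Gy sry; apply/eqP => Ay0.
have sy : r = s *: y.
  by rewrite -Gy mulmxDl -mulmxA Ay0 mulmx0 add0r mul_scalar_mx.
have : dot r r = s by rewrite {2}sy dotZr sry.
rewrite -frob_sqr_dot /s => h; have := exprn_gt0 2 mu0; lra.
Qed.

(** Here A p = c (r - s y), and the relations between r, s and y make the
    squared lengths of A p + r and A p - r equal to the perfect squares
    mu^2 (c + 1)^2 and mu^2 (c - 1)^2. *)
Lemma certificate_ratio y (c : R) : 0 < mu ->
  (A *m A^T + s%:M) *m y = r -> dot r y <= 1 -> s * dot r y = s ->
  frob (c *: (A^T *m y)) = 1 -> error_ratio A r (c *: (A^T *m y)) = mu.
Proof.
move=> mu0 Gy ry1 sry c1.
have AAy : A *m (A^T *m y) = r - s *: y.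
  by rewrite -{1}Gy mulmxDl mul_scalar_mx mulmxA addrK.
have yAAy : dot (A^T *m y) (A^T *m y) = dot r y - s * dot y y.
  by rewrite -dot_mulmxl AAy !dot_linear.
have c2 : c ^+ 2 * (dot r y - s * dot y y) = 1.
  by rewrite -yAAy -(expr1n R 2) -c1 frob_sqr_dot !dot_linear; ring.
(* |A^T y|^2 = r . y - s |y|^2 is at most 1, so normalizing stretches. *)
have c_ge1 : 1 <= `|c|.
  rewrite -ler_sqr ?nnegrE // real_normK ?num_real // expr1n -c2.
  rewrite ler_piMr ?sqr_ge0 //.
  by have := mulr_ge0 deficit_ge0 (dot_ge0 y); lra.
have norm_pm (e : R) : e ^+ 2 = 1 ->
    frob (A *m (c *: (A^T *m y)) + e *: r) = mu * `|c + e|.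
  move=> e2; apply/eqP.
  rewrite -(eqrXn2 (n := 2)) ?frob_ge0 ?mulr_ge0 ?(ltW mu0) //.
  rewrite exprMn real_normK ?num_real // -scalemxAr AAy frob_sqr_dot.
  rewrite !dot_linear (dotC y r).
  have -> : mu ^+ 2 = dot r r - s by rewrite -frob_sqr_dot /s; ring.
  set f := dot r r; set b := dot r y in sry c2 *; set Y := dot y y in c2 *.
  (* The difference of the two sides, as a combination of the three relations
     c2, sry and e2. *)
  apply/eqP/subr0_eq; transitivity (- s * (c ^+ 2 * (b - s * Y) - 1)
      - (c ^+ 2 + 2 * e * c) * (s * b - s) + s * (e ^+ 2 - 1)); first by ring.
  by rewrite c2 sry e2; ring.
rewrite error_ratioE.
have := norm_pm 1 (expr1n _ _); rewrite scale1r => ->.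
have := norm_pm (-1) (sqrr_sign _ 1); rewrite scaleN1r => ->.
rewrite -mulrBr normrM (gtr0_norm mu0) -mulrA.
suff -> : `| `|c + 1| - `|c - 1| | = 2 by rewrite divff ?mulr1 ?pnatr_eq0.
case: (lerP 0 c) => c0.
  have c_ge : 1 <= c by rewrite -[c]ger0_norm.
  by rewrite (ger0_norm (x := c + 1)) ?(ger0_norm (x := c - 1)) ?ger0_norm; lra.
have c_ge : 1 <= - c by rewrite -ltr0_norm.
by rewrite (ler0_norm (x := c + 1)) ?(ler0_norm (x := c - 1)) ?ler0_norm; lra.
Qed.

Lemma regularized_gram_unit : 0 < s -> A^T *m A + s%:M \in unitmx.
Proof.
move=> s0; rewrite -row_free_unit -kermx_eq0; apply/eqP/row_matrixP => i.
set M := A^T *m A + _; set v := (row i (kermx M))^T.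
have MT : M^T = M by rewrite /M linearD /= trmx_mul trmxK tr_scalar_mx.
have Mv : M *m v = 0.
  by rewrite /v -{1}MT -trmx_mul -row_mul mulmx_ker row0 trmx0.
have : dot v (M *m v) = 0 by rewrite Mv dot0r.
rewrite mulmxDl mul_scalar_mx dotDr dotZr -mulmxA dot_mulmxr trmxK => h.
rewrite row0 -[row i _]trmxK -/v (_ : v = 0) ?trmx0 //; apply: dot_eq0.
apply/eqP; rewrite -(mulrI_eq0 _ (mulfI (lt0r_neq0 s0))) eq_le.
rewrite (mulr_ge0 (ltW s0) (dot_ge0 _)) andbT -h lerDr; exact: dot_ge0.
Qed.

(** A^T commutes past the regularization: (A^T A + s I) A^T = A^T G. *)
Lemma gram_certificate y : (A *m A^T + s%:M) *m y = r ->
  (A^T *m A + s%:M) *m (A^T *m y) = A^T *m r.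
Proof.
move=> Gy; rewrite -[in RHS]Gy !mulmxDl !mul_scalar_mx mulmxDr -!mulmxA.
by rewrite scalemxAr.
Qed.
End Certificate.

Theorem theorem4 (R : realType) (m n : nat)
    (m_gt0 : (0 < m)%N) (n_gt0 : (0 < n)%N)
    (A : 'M[R]_(m, n)) (r : 'cV[R]_m) :
  let mu := backward_error A r in
  let M := A^T *m A + (frob r ^+ 2 - mu ^+ 2)%:M in
  let q := invmx M *m (A^T *m r) in
  0 < mu ->
  [/\ is_max [set error_ratio A r p | p in [set p : 'cV[R]_n | frob p = 1]] mu,
      mu < frob r -> M \in unitmx &
      M \in unitmx ->
        q != 0 /\
        forall c : R, frob (c *: q) = 1 -> error_ratio A r (c *: q) = mu].
Proof.
move=> mu M q mu0.
have [y [Gy ry1 sry]] := certificate_exists A r.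
have y0 := certificate_neq0 A r y mu0 Gy sry.
have ratio c := certificate_ratio A r y c mu0 Gy ry1 sry.
split.
- split; last by move=> _ [p p1 <-]; exact: error_ratio_le.
  have p1 : frob ((frob (A^T *m y))^-1 *: (A^T *m y)) = 1.
    rewrite frobZ ger0_norm ?invr_ge0 ?frob_ge0 // mulVf //.
    by apply: contra_neq y0 => /frob_eq0.
  by exists ((frob (A^T *m y))^-1 *: (A^T *m y)); last exact: ratio.
- move=> mur; apply: regularized_gram_unit; rewrite subr_gt0.
  by rewrite ltr_sqr ?nnegrE ?frob_ge0 ?ltW.
- move=> uM; have -> : q = A^T *m y.
    by rewrite /q -(gram_certificate A r y Gy) mulKmx.
  by split.
Qed.
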